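(* Let $1\le q\le\log_2 3$ and $\kappa_q=\frac{2^{q+1}-3}{3}$. For every four-point Ptolemaic metric $d$ on distinct points $A,B,U,V$, with distinguished pair $A,B$, the Schur complement matrix $S$ (indexed by $\{U,V\}$, defined in the context) satisfies \[ S_{UV}\ge-\kappa_q\sqrt{S_{UU}S_{VV}}. \] The constant is sharp.
   Context: A metric is Ptolemaic if $d(x,y)d(z,w)\le d(x,z)d(y,w)+d(x,w)d(y,z)$ for all points $x,y,z,w$. Put $D=d(A,B)^q$, and for $W\in\{U,V\}$ put $R_W=d(A,W)^q$, $T_W=d(B,W)^q$, $g_W=\frac{D+R_W-T_W}{2}$. Let $H$ be the symmetric matrix indexed by $\{U,V\}$ with $H_{UU}=R_U$, $H_{VV}=R_V$, $H_{UV}=\frac{R_U+R_V-d(U,V)^q}{2}$. Define $S=H-D^{-1}gg^{\mathsf T}$, where $g=(g_U,g_V)^{\mathsf T}$. (For $q\le 2$ the diagonal entries of $S$ are nonnegative.) Sharpness means that $\kappa_q$ cannot be replaced by a smaller constant. *)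

(* Defs.v *)
From HB Require Import structures.
From mathcomp Require Import all_boot all_order all_algebra.
From mathcomp Require Import all_classical all_reals all_analysis.

Set Implicit Arguments.
Unset Strict Implicit.
Unset Printing Implicit Defensive.

Import Order.TTheory GRing.Theory Num.Theory.
Import numFieldNormedType.Exports.

Local Open Scope classical_set_scope.
Local Open Scope ring_scope.

Definition log2 (R : realType) (x : R) : R := ln x / ln 2.

Definition kappa (R : realType) (q : R) : R := (2 `^ (q + 1) - 3) / 3.

Definition ptolemaic (R : realType) (T : metricType R) : Prop :=
  forall x y z w : T,
    mdist x y * mdist z w <= mdist x z * mdist y w + mdist x w * mdist y z.

Definition four_points (T : choiceType) (A B U V : T) : Prop :=
  uniq [:: A; B; U; V] /\ [set: T] = [set A; B; U; V].

(* The index set {U, V} of the matrices is encoded by 'I_2: 0 is U, 1 is V. *)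
Definition iU : 'I_2 := ord0.
Definition iV : 'I_2 := ord_max.

Section SchurComplement.
Variables (R : realType) (T : metricType R) (q : R) (A B U V : T).

Definition pt (i : 'I_2) : T := if i == iU then U else V.

Definition dqAB : R := mdist A B `^ q.
Definition dqA (W : T) : R := mdist A W `^ q.
Definition dqB (W : T) : R := mdist B W `^ q.
Definition schurg (W : T) : R := (dqAB + dqA W - dqB W) / 2.

Definition matH : 'M[R]_2 :=
  \matrix_(i < 2, j < 2)
    if i == j then dqA (pt i)
    else (dqA (pt i) + dqA (pt j) - mdist (pt i) (pt j) `^ q) / 2.

Definition vecg : 'cV[R]_2 := \col_(i < 2) schurg (pt i).

Definition matS : 'M[R]_2 := matH - dqAB^-1 *: (vecg *m vecg^T).

End SchurComplement.

Definition schur_bound (R : realType) (q c : R) : Prop :=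
  forall (T : metricType R) (A B U V : T),
    ptolemaic T -> four_points A B U V ->
    let S := matS q A B U V in
    S iU iV >= - c * Num.sqrt (S iU iU * S iV iV).

(* Main.v *)
(* Put f = d^(q/2), so that d^q = f^2, and mu = 2^(q-1) - 1, which lies in [0, 1/2]
   and satisfies kappa_q = (4 mu + 1) / 3.  For 1 <= q <= 2 one has
   (y + z)^q <= y^q + z^q + 2 mu (y z)^(q/2), so the triangle inequality says that
   the triangles with side lengths f have cosines at least -mu >= -1/2, that is
   angles at most 2 pi / 3.  Let t1, t2, t3 and s1, s2, s3 be the angles of ABU and
   ABV, at A, at B and at the third vertex.  The sum of all ti + si is 2 pi, so some
   ti + si lies in [2 pi / 3, 4 pi / 3], and there cos (ti + si) <= -1/2 gives
   kappa_q sin ti sin si - cos ti cos si >= mu.  This is the claim once d(U, V) is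
   bounded by the triangle inequality through A (i = 1) or B (i = 2), or by
   Ptolemy's inequality (i = 3), because D S_UV has one expression in terms of the
   angles at each of these three places.  Equality holds when all distances are 1
   except d(U, V) = 2. *)
Require Import Defs.
From HB Require Import structures.
From mathcomp Require Import all_boot all_order all_algebra.
From mathcomp Require Import all_classical all_reals all_analysis.
From mathcomp Require Import ring lra.

Set Implicit Arguments.
Unset Strict Implicit.
Unset Printing Implicit Defensive.

Import Order.TTheory GRing.Theory Num.Theory.
Import numFieldNormedType.Exports.
Local Open Scope ring_scope.

(** * Inequalities for real powers *)

(** Two instances of [1 + x <= expR x], at [(1 - r) * ln w] and at [- (r * ln w)], are averaged with
    weights [r] and [1 - r], which cancels the logarithms. *)
Lemma powR_bernoulli_le (R : realType) (r w : R) :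
  0 <= r <= 1 -> 0 < w -> w `^ r <= 1 - r + r * w.
Proof.
move=> /andP[r0 r1] w0; rewrite /powR gt_eqF//.
have Ew : w = expR (ln w) by rewrite lnK.
have h1 : expR (r * ln w) * (1 + (1 - r) * ln w) <= w.
  rewrite [leRHS]Ew (_ : expR (ln w) = expR (r * ln w) * expR ((1 - r) * ln w)).
    by rewrite ler_wpM2l ?expR_ge0 ?expR_ge1Dx.
  by rewrite -expRD; congr expR; ring.
have h2 : expR (r * ln w) * (1 - r * ln w) <= 1.
  rewrite -[leRHS](expRxMexpNx_1 (r * ln w)).
  by rewrite ler_wpM2l ?expR_ge0 ?expR_ge1Dx.
have := lerD (ler_wpM2l r0 h1) (ler_wpM2l (_ : 0 <= 1 - r) h2).
rewrite subr_ge0 => /(_ r1); lra.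
Qed.

(** Gives the sign of the derivative in [is_derive_powR_quotient]. Bernoulli at exponent [q - 1]
    separates the two sides by the same polynomial [(1 + (q - 1) * v) * (1 - v)]. *)
Lemma powR1D_mul1B_le (R : realType) (q v : R) : 1 <= q <= 2 -> 0 < v <= 1 ->
  (1 + v) `^ (q - 1) * (1 - v) <= 1 - v `^ q.
Proof.
move=> /andP[q1 q2] /andP[v0 v1].
have h1 : (1 + v) `^ (q - 1) <= 1 + (q - 1) * v.
  rewrite (_ : 1 + (q - 1) * v = 1 - (q - 1) + (q - 1) * (1 + v)); last by ring.
  by apply: powR_bernoulli_le; lra.
have h2 : v `^ (q - 1) <= 1 - (q - 1) + (q - 1) * v.
  by apply: powR_bernoulli_le => //; lra.
have Eq : v `^ q = v * v `^ (q - 1).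
  by rewrite mulr_powRB1 ?(ltW v0)//; lra.
have := ler_wpM2r (_ : 0 <= 1 - v) h1; have := ler_wpM2l (ltW v0) h2.
rewrite subr_ge0 Eq => h3 /(_ v1) h4; lra.
Qed.

Lemma powR_factor_base (R : realType) (w s : R) : 0 < w -> w `^ s = w * w `^ (s - 1).
Proof.
move=> w0; rewrite -[X in X * _]powRr1 ?ltW// -powRD.
  by congr (_ `^ _); ring.
by apply/implyP => _; exact: lt0r_neq0.
Qed.

Lemma is_derive_powR_quotient (R : realType) (q v : R) : 0 < v ->
  is_derive v 1
    (fun v : R => ((1 + v) `^ q - 1 - v `^ q) * v `^ (- (q / 2)))
    (q / 2 * ((1 - v `^ q - (1 + v) `^ (q - 1) * (1 - v)) * v `^ (- (q / 2) - 1))).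
Proof.
move=> v0.
have v10 : 0 < 1 + v by lra.
have d0 : is_derive v 1 (fun v : R => 1 + v) 1.
  by rewrite -[X in is_derive _ _ _ X]add0r; apply: is_deriveD.
have d1 : is_derive v 1 (fun v : R => (1 + v) `^ q) (q * (1 + v) `^ (q - 1)).
  have := is_derive1_comp (is_derive1_powR q v10) d0.
  by rewrite mulr1.
have d2 := is_derive1_powR q v0.
have d3 := is_derive1_powR (- (q / 2)) v0.
have := is_deriveM (is_deriveB (is_deriveB d1 (is_derive_cst (1 : R) v 1)) d2) d3.
move=> H; apply: (is_derive_eq H).
rewrite /GRing.scale /= -![(_ - _ : _ -> _) _]/(_ - _) /cst.
(* With one factor of the base split off, the identity is rational in the remaining powers. *)
rewrite (@powR_factor_base _ v (- (q / 2))) // (@powR_factor_base _ v q) //.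
rewrite (@powR_factor_base _ (1 + v) q) //.
by field.
Qed.

(* The difference (y + z)^q - y^q - z^q divided by (y z)^(q/2) depends only
   on v = z / y and is nondecreasing in v on (0, 1], so it is largest at y = z. *)
Lemma powRD_le_half_powers (R : realType) (q y z : R) : 1 <= q <= 2 -> 0 < y -> 0 < z ->
  (y + z) `^ q <=
    y `^ q + z `^ q + (2 `^ q - 2) * (y `^ (q / 2) * z `^ (q / 2)).
Proof.
move=> q12; wlog zy : y z / z <= y => [hw y0 z0|y0 z0].
  have [/hw|/ltW/hw] := leP z y; first exact.
  by rewrite (addrC y) (addrC (y `^ q)) [y `^ _ * _]mulrC; apply.
have [v [v0 v1 zE]] : exists v : R, [/\ 0 < v, v <= 1 & z = v * y].
  exists (z / y); split; first by rewrite divr_gt0.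
    by rewrite ler_pdivrMr // mul1r.
  by rewrite divfK ?gt_eqF.
pose G (v : R) := ((1 + v) `^ q - 1 - v `^ q) * v `^ (- (q / 2)).
have Gd (x : R) (x0 : 0 < x) := is_derive_powR_quotient q x0; rewrite -/G in Gd.
have GvG1 : G v <= G 1.
  apply: (@ger0_derive1_ndecr R G v 1) => //.
  - move=> x; rewrite in_itv /= => /andP[vx x1].
    have x0 := lt_trans v0 vx.
    by have [] := Gd x x0.
  - move=> x; rewrite in_itv /= => /andP[vx x1].
    have x0 := lt_trans v0 vx.
    have [_] := Gd x x0; rewrite derive1E => ->.
    have h := powR1D_mul1B_le q12 (_ : 0 < x <= 1).
    rewrite !mulr_ge0 ?powR_ge0 ?invr_ge0 ?subr_ge0 ?h ?x0 ?ltW//; lra.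
  - apply: derivable_within_continuous => x; rewrite in_itv /= => /andP[vx x1].
    by have [] := Gd x (lt_le_trans v0 vx).
have {GvG1} : (1 + v) `^ q <= 1 + v `^ q + (2 `^ q - 2) * v `^ (q / 2).
  move: GvG1; rewrite /G !powR1 mulr1 powRN ler_pdivrMr ?powR_gt0//.
  rewrite (_ : 1 + 1 = 2) //; lra.
have yq0 := powR_gt0 q y0.
have -> : (y + z) `^ q = y `^ q * (1 + v) `^ q.
  by rewrite -powRM ?(ltW y0) ?addr_ge0 ?(ltW v0)// mulrDr mulr1 mulrC {1}zE.
rewrite zE !powRM ?(ltW v0) ?(ltW y0)// => /(ler_wpM2l (ltW yq0))/le_trans; apply.
have yy : y `^ q = y `^ (q / 2) * y `^ (q / 2).
  by rewrite -powRD -?splitr//; apply/implyP => _; exact: lt0r_neq0.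
rewrite yy; lra.
Qed.

(** * Cosines and the angles of a triangle *)

Lemma cos_pi3 (R : realType) : cos (pi / 3 : R) = 2^-1.
Proof.
have pi0 := pi_gt0 R.
have c0 : 0 < cos (pi / 3 : R) by apply: cos_gt0_pihalf; lra.
have : cos (pi / 3 + (pi / 3 + pi / 3)) = -1 :> R.
  by rewrite -[RHS]cospi; congr cos; field.
rewrite !cosD !sinD; have := sin2cos2 (pi / 3 : R).
set c := cos _ in c0 *; set s := sin _ => hs hc.
(* The triple angle formula gives [4 c^3 - 3 c = -1], and [4 c^3 - 3 c + 1] factors in this way. *)
have h : (c + 1) * (2 * c - 1) ^+ 2 = 0.
  rewrite -[RHS](subrr (-1 : R)) -[X in _ = X - _]hc.
  have -> : c * (c * c - s * s) - s * (s * c + c * s) = c ^+ 3 - 3 * c * s ^+ 2 by ring.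
  by rewrite hs; ring.
move/eqP: h; rewrite mulf_eq0 sqrf_eq0 => /orP[] /eqP; lra.
Qed.

Lemma cos_le_Nhalf (R : realType) (d : R) :
  2 * pi / 3 <= d <= 4 * pi / 3 -> cos d <= - 2^-1.
Proof.
move=> /andP[d1 d2]; have pi0 := pi_gt0 R.
have -> : d = (d - pi) + pi by ring.
rewrite cosDpi lerN2 -cos_pi3 -(cos_norm (d - pi)).
have h : `|d - pi| <= pi / 3 by rewrite ler_norml; lra.
have [hn|hn] := eqVneq `|d - pi| (pi / 3); first by rewrite hn.
rewrite ltW // ltr_cos ?in_itv /=.
- by rewrite lt_neqAle hn.
- by rewrite normr_ge0 /=; lra.
- lra.
Qed.

Lemma acos_le_2pi3 (R : realType) (c : R) : - 2^-1 <= c <= 1 -> acos c <= 2 * pi / 3.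
Proof.
move=> /andP[c1 c2]; have pi0 := pi_gt0 R.
have c11 : -1 <= c <= 1 by lra.
rewrite leNgt; apply/negP => h.
have : cos (acos c) < cos (2 * pi / 3 : R).
  rewrite ltr_cos // in_itv /=; first by lra.
  by rewrite acos_ge0 ?acos_lepi.
have := @cos_le_Nhalf R (2 * pi / 3); rewrite acosK ?in_itv //=; lra.
Qed.

Lemma cos_eqN1 (R : realType) (x : R) : 0 <= x <= 2 * pi -> cos x = -1 -> x = pi.
Proof.
move=> x02 cx.
suff : `|x - pi| = 0 by move/eqP; rewrite normr_eq0 subr_eq0 => /eqP.
have pi0 := pi_gt0 R.
have hx : `|x - pi| <= pi by rewrite ler_norml; lra.
apply: cos_inj; rewrite ?in_itv /= ?normr_ge0 ?hx ?lexx ?ltW//.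
by rewrite cos_norm cos0 cosB cospi sinpi cx; ring.
Qed.

(** The law of cosines: the bound [- (x * y)] amounts to [cos t >= -1/2], and the square root is
    four times the area, by Heron. *)
Lemma angle_of_sides (R : realType) (x y z : R) : 0 < x -> 0 < y ->
  - (x * y) <= x ^+ 2 + y ^+ 2 - z ^+ 2 <= 2 * x * y ->
  exists t, [/\ 0 <= t <= 2 * pi / 3, x ^+ 2 + y ^+ 2 - z ^+ 2 = 2 * x * y * cos t
    & Num.sqrt (4 * x ^+ 2 * y ^+ 2 - (x ^+ 2 + y ^+ 2 - z ^+ 2) ^+ 2) =
      2 * x * y * sin t].
Proof.
move=> x0 y0 /andP[h1 h2].
have xy0 : 0 < 2 * x * y by rewrite !mulr_gt0.
pose c := (x ^+ 2 + y ^+ 2 - z ^+ 2) / (2 * x * y).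
have cE : x ^+ 2 + y ^+ 2 - z ^+ 2 = 2 * x * y * c.
  by rewrite mulrC divfK // gt_eqF.
have c1 : - 2^-1 <= c by rewrite ler_pdivlMr //; lra.
have c2 : c <= 1 by rewrite ler_pdivrMr //; lra.
have c11 : -1 <= c <= 1 by rewrite c2 andbT; lra.
exists (acos c); rewrite acosK ?in_itv // sin_acos // acos_ge0 // acos_le_2pi3 ?c1 //.
split => //; rewrite cE -[in RHS](ger0_norm (ltW xy0)) -sqrtr_sqr -sqrtrM ?sqr_ge0 //.
by congr Num.sqrt; ring.
Qed.

(** Since [K] is four times the area, one value serves all three vertices. *)
Lemma triangle_angles (R : realType) (m a b : R) :
  0 < m -> 0 < a -> 0 < b ->
  m ^+ 2 <= a ^+ 2 + b ^+ 2 + a * b ->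
  a ^+ 2 <= m ^+ 2 + b ^+ 2 + m * b ->
  b ^+ 2 <= m ^+ 2 + a ^+ 2 + m * a ->
  let K := Num.sqrt (4 * m ^+ 2 * a ^+ 2 - (m ^+ 2 + a ^+ 2 - b ^+ 2) ^+ 2) in
  exists t u v : R,
    [/\ [/\ 0 <= t <= 2 * pi / 3, 0 <= u <= 2 * pi / 3 & 0 <= v <= 2 * pi / 3],
      t + u + v = pi,
      m ^+ 2 + a ^+ 2 - b ^+ 2 = 2 * m * a * cos t /\ K = 2 * m * a * sin t,
      m ^+ 2 + b ^+ 2 - a ^+ 2 = 2 * m * b * cos u /\ K = 2 * m * b * sin u &
      a ^+ 2 + b ^+ 2 - m ^+ 2 = 2 * a * b * cos v /\ K = 2 * a * b * sin v].
Proof.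
move=> m0 a0 b0 hm ha hb K.
have tri (x y z : R) : 0 < x -> 0 < y -> 0 < z -> x ^+ 2 <= y ^+ 2 + z ^+ 2 + y * z -> x <= y + z.
  move=> x0 y0 z0 h; rewrite -(@ler_pXn2r _ 2) ?nnegrE ?addr_ge0 ?ltW //; nra.
have hm' := tri _ _ _ m0 a0 b0 hm.
have ha' := tri _ _ _ a0 m0 b0 ha.
have hb' := tri _ _ _ b0 m0 a0 hb.
have [|t [ht tc ts]] := @angle_of_sides R m a b m0 a0; first by apply/andP; split; nra.
have [|u [hu uc us]] := @angle_of_sides R m b a m0 b0; first by apply/andP; split; nra.
have [|v [hv vc vs]] := @angle_of_sides R a b m a0 b0; first by apply/andP; split; nra.
rewrite -/K in ts.
have usK : K = 2 * m * b * sin u by rewrite -us; congr Num.sqrt; ring.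
have vsK : K = 2 * a * b * sin v by rewrite -vs; congr Num.sqrt; ring.
exists t, u, v; split => //.
(* The angles add up to at most [3 * (2 * pi / 3)], so it suffices that their sum has cosine -1. *)
apply: cos_eqN1; first lra.
(* This product of [2 * m * a], [2 * m * b] and [2 * a * b] turns the cosines into polynomials in
   the sides and each sine into [K]. *)
have mab : 8 * m ^+ 2 * a ^+ 2 * b ^+ 2 != 0.
  by rewrite !mulf_neq0 ?expf_neq0 ?gt_eqF.
apply: (mulfI mab); rewrite cosD cosD sinD.
transitivity (2 * a * b * cos v * (2 * m * a * cos t * (2 * m * b * cos u) -
  2 * m * a * sin t * (2 * m * b * sin u)) - 2 * a * b * sin v *
  (2 * m * a * sin t * (2 * m * b * cos u) + 2 * m * a * cos t * (2 * m * b * sin u))).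
  ring.
have K2 : K ^+ 2 = 4 * a ^+ 2 * b ^+ 2 - (a ^+ 2 + b ^+ 2 - m ^+ 2) ^+ 2.
  by rewrite vc vsK !exprMn sin2cos2; ring.
rewrite -vc -tc -uc -usK -vsK -ts; clearbody K. ring: K2.
Qed.

(** * The bound in terms of angles *)

(** Average of [cos (s + t) <= -1/2] and [cos (s - t) <= 1] with weights [(1 + k) / 2] and
    [(1 - k) / 2], where [k = (4 * mu + 1) / 3] lies in [0, 1]. *)
Lemma sin_cos_weighted_ge (R : realType) (mu s t : R) : mu <= 2^-1 ->
  - 4^-1 <= mu -> 2 * pi / 3 <= s + t <= 4 * pi / 3 ->
  mu <= (4 * mu + 1) / 3 * (sin s * sin t) - cos s * cos t.
Proof.
move=> mu1 mu0 /cos_le_Nhalf; rewrite cosD => h1.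
have h2 : cos s * cos t + sin s * sin t <= 1 by rewrite -cosB cos_le1.
set S := sin s * sin t in h1 h2 *; set C := cos s * cos t in h1 h2 *.
have g1 : 0 <= (1 + (4 * mu + 1) / 3) * (- 2^-1 - (C - S)).
  by rewrite mulr_ge0 ?subr_ge0//; lra.
have g2 : 0 <= (1 - (4 * mu + 1) / 3) * (1 - (C + S)).
  by rewrite mulr_ge0 ?subr_ge0//; lra.
lra.
Qed.

(* m, a, b, c, e, x are d(A,B), d(A,U), d(B,U), d(A,V), d(B,V), d(U,V), each to
   the power q / 2. *)
Lemma schur_bound_half_powers (R : realType) (mu m a b c e x : R) :
  0 <= mu <= 2^-1 ->
  0 < m -> 0 < a -> 0 < b -> 0 < c -> 0 < e ->
  m ^+ 2 <= a ^+ 2 + b ^+ 2 + 2 * mu * (a * b) ->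
  a ^+ 2 <= m ^+ 2 + b ^+ 2 + 2 * mu * (m * b) ->
  b ^+ 2 <= m ^+ 2 + a ^+ 2 + 2 * mu * (m * a) ->
  m ^+ 2 <= c ^+ 2 + e ^+ 2 + 2 * mu * (c * e) ->
  c ^+ 2 <= m ^+ 2 + e ^+ 2 + 2 * mu * (m * e) ->
  e ^+ 2 <= m ^+ 2 + c ^+ 2 + 2 * mu * (m * c) ->
  x ^+ 2 <= a ^+ 2 + c ^+ 2 + 2 * mu * (a * c) ->
  x ^+ 2 <= b ^+ 2 + e ^+ 2 + 2 * mu * (b * e) ->
  (x * m) ^+ 2 <= (a * e) ^+ 2 + (b * c) ^+ 2 + 2 * mu * (a * e * (b * c)) ->
  - ((4 * mu + 1) / 3) *
    Num.sqrt ((4 * m ^+ 2 * a ^+ 2 - (m ^+ 2 + a ^+ 2 - b ^+ 2) ^+ 2) *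
      (4 * m ^+ 2 * c ^+ 2 - (m ^+ 2 + c ^+ 2 - e ^+ 2) ^+ 2)) <=
  2 * m ^+ 2 * (a ^+ 2 + c ^+ 2 - x ^+ 2) -
    (m ^+ 2 + a ^+ 2 - b ^+ 2) * (m ^+ 2 + c ^+ 2 - e ^+ 2).
Proof.
move=> /andP[mu0 mu1] m0 a0 b0 c0 e0 u1 u2 u3 v1 v2 v3 xA xB xP.
have weaken (y z : R) : 0 < y -> 0 < z -> 2 * mu * (y * z) <= y * z.
  by move=> y0 z0; rewrite ler_piMl ?mulr_ge0 ?(ltW y0) ?(ltW z0) //; lra.
have := weaken _ _ a0 b0; have := weaken _ _ m0 b0; have := weaken _ _ m0 a0.
have := weaken _ _ c0 e0; have := weaken _ _ m0 e0; have := weaken _ _ m0 c0.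
move=> w1 w2 w3 w4 w5 w6.
have [||| t1 [t2 [t3 [[ht1 ht2 ht3] tS [tc1 ts1] [tc2 ts2] [tc3 ts3]]]]] :=
  triangle_angles m0 a0 b0; try lra.
have [||| s1 [s2 [s3 [[hs1 hs2 hs3] sS [sc1 ss1] [sc2 ss2] [sc3 ss3]]]]] :=
  triangle_angles m0 c0 e0; try lra.
rewrite sqrtrM; last first.
  rewrite tc1 (_ : _ - _ = (2 * m * a * sin t1) ^+ 2) ?sqr_ge0 //.
  by rewrite [RHS]exprMn sin2cos2; ring.
set K := Num.sqrt _ in ts1 ts2 ts3 *; set L := Num.sqrt _ in ss1 ss2 ss3 *.
have muN : - 4^-1 <= mu by lra.
(* Shared by the three cases: [s] is the angle of ABU between sides [y], [z], and [t] that of ABV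
   between [y'], [w]. *)
have step (s t y z w y' : R) : 2 * pi / 3 <= s + t -> s <= 2 * pi / 3 -> t <= 2 * pi / 3 ->
    0 < y -> 0 < z -> 0 < w -> 0 < y' -> K = 2 * y * z * sin s -> L = 2 * y' * w * sin t ->
    4 * mu * (y * z * y' * w) <=
    (4 * mu + 1) / 3 * (K * L) - 2 * y * z * cos s * (2 * y' * w * cos t).
  move=> h1 h2 h3 y0 z0 w0 y'0 -> ->.
  have := sin_cos_weighted_ge mu1 muN (_ : 2 * pi / 3 <= s + t <= 4 * pi / 3).
  have hst : 2 * pi / 3 <= s + t <= 4 * pi / 3 by lra.
  move=> /(_ hst) hh.
  have yzw : 0 < 4 * (y * z * y' * w) by rewrite !mulr_gt0.
  have := ler_wpM2l (ltW yzw) hh; lra.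
have [hA|hA] := leP (2 * pi / 3) (t1 + s1).
  have := @step t1 s1 m a c m hA; rewrite -tc1 -sc1.
  have := ler_wpM2l (_ : 0 <= 2 * m ^+ 2) xA.
  rewrite mulr_ge0 ?sqr_ge0 // => /(_ isT) h1 h2.
  have {}h2 := h2 (_ : t1 <= _) (_ : s1 <= _) m0 a0 c0 m0 ts1 ss1.
  have {}h2 := h2 (proj2 (andP ht1)) (proj2 (andP hs1)).
  lra.
(* The right-hand side is unchanged when [a], [c] are exchanged with [b], [e]. *)
have [hB|hB] := leP (2 * pi / 3) (t2 + s2).
  have := @step t2 s2 m b e m hB; rewrite -tc2 -sc2.
  have := ler_wpM2l (_ : 0 <= 2 * m ^+ 2) xB.
  rewrite mulr_ge0 ?sqr_ge0 // => /(_ isT) h1 h2.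
  have {}h2 := h2 (_ : t2 <= _) (_ : s2 <= _) m0 b0 e0 m0 ts2 ss2.
  have {}h2 := h2 (proj2 (andP ht2)) (proj2 (andP hs2)).
  lra.
(* The right-hand side also equals [2 * ((a * e)^2 + (b * c)^2 - (x * m)^2) - (a^2 + b^2 - m^2) *
   (c^2 + e^2 - m^2)], to which [xP] applies. *)
have hC : 2 * pi / 3 <= t3 + s3 by lra.
have := @step t3 s3 a b e c hC; rewrite -tc3 -sc3 => h2.
have {}h2 := h2 (_ : t3 <= _) (_ : s3 <= _) a0 b0 e0 c0 ts3 ss3.
have {}h2 := h2 (proj2 (andP ht3)) (proj2 (andP hs3)).
lra.
Qed.

(** * From the metric to the Schur complement *)

Lemma matS_diag (R : realType) (T : metricType R) (q : R) (A B U V : T) i :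
  matS q A B U V i i =
  dqA q A (pt U V i) - (dqAB q A B)^-1 * schurg q A B (pt U V i) ^+ 2.
Proof. by rewrite !mxE big_ord1 !mxE eqxx expr2. Qed.

Lemma matS_offdiag (R : realType) (T : metricType R) (q : R) (A B U V : T) :
  matS q A B U V iU iV =
  (dqA q A U + dqA q A V - mdist U V `^ q) / 2
  - (dqAB q A B)^-1 * (schurg q A B U * schurg q A B V).
Proof. by rewrite !mxE big_ord1 !mxE. Qed.

(** Scaling by [4 * d], which enters the square root as its square. *)
Lemma schur_bound_clear_denominators (R : realType) (k d r1 t1 r2 t2 x : R) : 0 < d ->
  - k * Num.sqrt ((4 * d * r1 - (d + r1 - t1) ^+ 2) *
      (4 * d * r2 - (d + r2 - t2) ^+ 2)) <=
    2 * d * (r1 + r2 - x) - (d + r1 - t1) * (d + r2 - t2) ->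
  - k * Num.sqrt ((r1 - d^-1 * ((d + r1 - t1) / 2) ^+ 2) *
      (r2 - d^-1 * ((d + r2 - t2) / 2) ^+ 2)) <=
    (r1 + r2 - x) / 2 - d^-1 * ((d + r1 - t1) / 2 * ((d + r2 - t2) / 2)).
Proof.
move=> d0 h; have dn0 := lt0r_neq0 d0.
have k0 : 0 < 4 * d by rewrite mulr_gt0.
rewrite -(ler_pM2l k0) mulrCA -[X in _ * (X * _)](ger0_norm (ltW k0)) -sqrtr_sqr.
rewrite -sqrtrM ?sqr_ge0 //.
have -> : (4 * d) ^+ 2 * ((r1 - d^-1 * ((d + r1 - t1) / 2) ^+ 2) *
      (r2 - d^-1 * ((d + r2 - t2) / 2) ^+ 2)) =
   (4 * d * r1 - (d + r1 - t1) ^+ 2) * (4 * d * r2 - (d + r2 - t2) ^+ 2).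
  by field.
have -> : 4 * d * ((r1 + r2 - x) / 2 -
    d^-1 * ((d + r1 - t1) / 2 * ((d + r2 - t2) / 2))) =
    2 * d * (r1 + r2 - x) - (d + r1 - t1) * (d + r2 - t2) by field.
by [].
Qed.

Lemma schur_bound_kappa (R : realType) (q : R) : 1 <= q -> q <= log2 3 ->
  schur_bound q (kappa q).
Proof.
move=> q1 q2 T A B U V ptol [/and4P[+ + UV _] _]; lazy zeta.
rewrite !inE !negb_or in UV * => /and3P[AB AU AV] /andP[BU BV].
have ln2 : 0 < ln 2 :> R by rewrite ln_gt0 // ltr1n.
have qln : q * ln 2 <= ln 3 by rewrite -ler_pdivlMr.
have two_le : 2 <= 2 `^ q :> R by apply: le1r_powR => //; rewrite ler1n.
(* Equivalent to [mu <= 1/2] for the [mu] below. *)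
have le_three : 2 `^ q <= 3 :> R.
  by rewrite /powR gt_eqF // -[leRHS]lnK ?posrE // ler_expR.
have q12 : 1 <= q <= 2.
  rewrite q1 /= -(ler_pM2r ln2); apply: (le_trans qln).
  rewrite -ln_powR ler_ln ?posrE ?powR_gt0 // powR_mulrn //.
  by rewrite -natrX ler_nat.
pose mu : R := (2 `^ q - 2) / 2.
pose f (x y : T) := mdist x y `^ (q / 2).
have fE x y : mdist x y `^ q = f x y ^+ 2.
  by rewrite /f expr2 -powRD -?splitr //; apply/implyP => /eqP; lra.
have fC x y : f x y = f y x by rewrite /f metric_sym.
have f_gt0 x y : x != y -> 0 < f x y by move=> xy; rewrite powR_gt0 // mdist_gt0.
have pw (y z w : R) : 0 <= w -> 0 < y -> 0 < z -> w <= y + z ->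
    w `^ q <= y `^ q + z `^ q + 2 * mu * (y `^ (q / 2) * z `^ (q / 2)).
  move=> w0 y0 z0 wyz; rewrite (_ : 2 * mu = 2 `^ q - 2); last by rewrite /mu; field.
  apply: le_trans (powRD_le_half_powers q12 y0 z0).
  by rewrite ge0_ler_powR ?nnegrE ?(le_trans ler01 q1) ?addr_ge0 ?(ltW y0) ?(ltW z0).
have tri x y z : x != y -> y != z ->
    f x z ^+ 2 <= f x y ^+ 2 + f y z ^+ 2 + 2 * mu * (f x y * f y z).
  by move=> xy yz; rewrite -!fE pw ?mdist_ge0 ?mdist_gt0 ?metric_triangle.
(* Ptolemy's inequality has the shape of a triangle inequality between products of distances, so
   [pw] applies to it too. *)
have hP : (f U V * f A B) ^+ 2 <= (f A U * f B V) ^+ 2 + (f B U * f A V) ^+ 2 +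
    2 * mu * (f A U * f B V * (f B U * f A V)).
  have pos (x y : T) : x != y -> 0 < mdist x y by rewrite mdist_gt0.
  have := ptol U V A B; rewrite (metric_sym U A) (metric_sym U B).
  rewrite (metric_sym V A) (metric_sym V B) => UVAB.
  have := pw _ _ _ (mulr_ge0 (mdist_ge0 U V) (mdist_ge0 A B))
    (mulr_gt0 (pos _ _ AU) (pos _ _ BV)) (mulr_gt0 (pos _ _ BU) (pos _ _ AV)) UVAB.
  by rewrite !powRM ?mdist_ge0 // !exprMn -!fE.
have m2 : 0 < f A B ^+ 2 by rewrite exprn_gt0 ?f_gt0.
rewrite !matS_diag matS_offdiag /pt eqxx /= /schurg /dqAB /dqA /dqB !fE.
rewrite (_ : kappa q = (4 * mu + 1) / 3); last first.
  rewrite /kappa powRD ?powRr1 // /mu; first by field.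
  by rewrite pnatr_eq0 implybT.
apply: schur_bound_clear_denominators => //; apply: schur_bound_half_powers; rewrite ?f_gt0 //.
- rewrite /mu; lra.
- by rewrite (fC B U); apply: tri => //; rewrite eq_sym.
- exact: tri.
- by rewrite (fC A B); apply: tri => //; rewrite eq_sym.
- by rewrite (fC B V); apply: tri => //; rewrite eq_sym.
- exact: tri.
- by rewrite (fC A B); apply: tri => //; rewrite eq_sym.
- by rewrite (fC A U); apply: tri => //; rewrite eq_sym.
- by rewrite (fC B U); apply: tri => //; rewrite eq_sym.
Qed.

(** * Sharpness *)

(* A, B, U, V are encoded as (false, false), (false, true), (true, false),
   (true, true); d(U, V) = 2 and all other distances are 1. *)
Definition extremal_space (R : realType) : Type := (bool * bool)%type.

HB.instance Definition _ (R : realType) := Choice.on (extremal_space R).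

Definition extremal_dist (R : realType) (x y : extremal_space R) : R :=
  ((x != y) + [&& x.1, y.1 & x != y])%:R.

Lemma extremal_distxx (R : realType) (x : extremal_space R) :
  extremal_dist x x = 0.
Proof. by rewrite /extremal_dist eqxx !andbF. Qed.

Lemma extremal_dist_positivity (R : realType) (x y : extremal_space R) :
  extremal_dist x y = 0 -> x = y.
Proof.
rewrite /extremal_dist; move/eqP; rewrite pnatr_eq0 addn_eq0 eqb0 negbK.
by case/andP => /eqP.
Qed.

Lemma extremal_dist_sym (R : realType) (x y : extremal_space R) :
  extremal_dist x y = extremal_dist y x.
Proof. by rewrite /extremal_dist eq_sym andbCA. Qed.

Lemma extremal_dist_triangle (R : realType) (y x z : extremal_space R) :
  extremal_dist x z <= extremal_dist x y + extremal_dist y z.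
Proof.
rewrite /extremal_dist -natrD ler_nat.
by move: x y z => [[] []] [[] []] [[] []].
Qed.

HB.instance Definition _ (R : realType) := isMetric.Build R (extremal_space R)
  (@extremal_distxx R) (@extremal_dist_positivity R) (@extremal_dist_sym R)
  (@extremal_dist_triangle R).

Lemma ptolemaic_extremal_space (R : realType) : ptolemaic (extremal_space R).
Proof.
move=> x y z w; rewrite /mdist /= /extremal_dist -!natrM -natrD ler_nat.
by move: x y z w => [[] []] [[] []] [[] []] [[] []].
Qed.

Lemma schur_bound_ge_kappa (R : realType) (q c : R) :
  schur_bound q c -> kappa q <= c.
Proof.
pose T : metricType R := extremal_space R.
move=> /(_ T (false, false) (false, true) (true, false) (true, true)).
move=> /(_ (@ptolemaic_extremal_space R)).
have fp : four_points ((false, false) : T) (false, true) (true, false) (true, true).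
  split=> //; apply/seteqP; split=> // -[[] []] _ /=; tauto.
move=> /(_ fp); lazy zeta.
rewrite !matS_diag matS_offdiag /pt eqxx /= /schurg /dqAB /dqA /dqB.
rewrite /mdist /= /extremal_dist /= !addn0 addn1 !powR1.
(* Both diagonal entries of [S] are [1 - 1/4 = 3/4]; the off-diagonal one is [- (3/4) * kappa q]. *)
rewrite [X in Num.sqrt X](_ : _ = (3 / 4) ^+ 2); last by field.
rewrite sqrtr_sqr ger0_norm // /kappa powRD ?powRr1 //; first by lra.
by rewrite pnatr_eq0 implybT.
Qed.

Theorem proposition4p3 (R : realType) (q : R) (hq1 : 1 <= q)
    (hq2 : q <= log2 3) :
  schur_bound q (kappa q) /\
  (forall c : R, c < kappa q -> ~ schur_bound q c).
Proof.
split; first exact: schur_bound_kappa.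
by move=> c; rewrite ltNge => /negP c_lt /schur_bound_ge_kappa.
Qed.
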